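(* Let $n\ge 1$ and $r\ge 1$. The $r$-th Johnson homomorphism of $\mathrm{End}(F_n)$, $$\tilde\tau_r:\mathrm{gr}^r(\mathcal E_*(n))\to\mathrm{Hom}(H,\mathcal L_{r+1}(n)),\qquad \tilde\tau_r([f])(x\Gamma_2)=f(x)x^{-1}\,\Gamma_{r+2}\quad(f\in\mathcal E_r(n),\ x\in F_n),$$ is an isomorphism of abelian groups.
   Context: $F_n$ is the free group of rank $n$, $\Gamma_r=\Gamma_r(F_n)$ its lower central series ($\Gamma_1=F_n$), $\mathcal L_r(n)=\Gamma_r/\Gamma_{r+1}$ and $H=\mathcal L_1(n)$. For $r\ge 0$, $\mathcal E_r(n)=\ker(\mathrm{End}(F_n)\to\mathrm{End}(F_n/\Gamma_{r+1}))=\{f\in\mathrm{End}(F_n)\mid f(x)x^{-1}\in\Gamma_{r+1}\text{ for all }x\in F_n\}$, a monoid under composition. For $N\ge r$ define the equivalence relation $\sim_N$ on $\mathcal E_r(n)$ by $f\sim_N g$ iff $f(x)x^{-1}\equiv g(x)x^{-1}\pmod{\Gamma_{N+1}}$ for all $x\in F_n$; composition induces a group structure on $\mathcal E_r(n)/{\sim_N}$ when $r\ge1$. Put $\mathrm{gr}^r(\mathcal E_*(n)):=\mathcal E_r(n)/{\sim_{r+1}}$. The map $\tilde\tau_r$ is a well-defined injective group homomorphism. *)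

(* Defs.v *)
From HB Require Import structures.
From mathcomp Require Import all_boot generic_quotient.
From mathcomp Require Import boolp classical_sets.

Set Implicit Arguments.
Unset Strict Implicit.
Unset Printing Implicit Defensive.

Local Open Scope classical_set_scope.
Local Open Scope quotient_scope.
Local Open Scope group_scope.

Notation "{ 'hom' G -> H }" := (UMagmaMorphism.type G%type H%type)
  (at level 0, G at level 98, H at level 99, format "{ 'hom'  G  ->  H }")
  : type_scope.

Lemma hom_ext (G H : groupType) (f g : {hom G -> H}) : f =1 g -> f = g.
Proof.
case: f g => [f [[f1] [fM]]] [g [[g1] [gM]]] /= /funext fg.
rewrite fg in f1 fM *.
by rewrite (Prop_irrelevance f1 g1) (Prop_irrelevance fM gM).
Qed.

HB.instance Definition _ (G H : groupType) := gen_eqMixin {hom G -> H}.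
HB.instance Definition _ (G H : groupType) := gen_choiceMixin {hom G -> H}.

HB.mixin Record isAbelian A of Group A := {
  mulgC : commutative (@mul A)
}.

#[short(type="abelGroupType")]
HB.structure Definition AbelGroup := {A of isAbelian A & Group A}.

Section HomGroup.
Variables (G : groupType) (A : abelGroupType).

Definition Hom := {hom G -> A}.
HB.instance Definition _ := Choice.on Hom.

Implicit Types u v w : Hom.

Definition hom_one_fun (x : G) : A := 1.
Fact hom_one_subproof : monoid_morphism hom_one_fun.
Proof. by split=> // x y; rewrite /hom_one_fun mulg1. Qed.
HB.instance Definition _ :=
  isUMagmaMorphism.Build G A hom_one_fun hom_one_subproof.
Definition hom_one : Hom := hom_one_fun : {hom G -> A}.

Definition hom_mul_fun u v (x : G) : A := u x * v x.
Fact hom_mul_subproof u v : monoid_morphism (hom_mul_fun u v).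
Proof.
split=> [|x y]; rewrite /hom_mul_fun ?gmulf1 ?mulg1 // !gmulfM.
by rewrite -!mulgA; congr (_ * _); rewrite !mulgA [v x * _]mulgC.
Qed.
HB.instance Definition _ u v :=
  isUMagmaMorphism.Build G A (hom_mul_fun u v) (hom_mul_subproof u v).
Definition hom_mul u v : Hom := hom_mul_fun u v : {hom G -> A}.

Definition hom_inv_fun u (x : G) : A := (u x)^-1.
Fact hom_inv_subproof u : monoid_morphism (hom_inv_fun u).
Proof.
split=> [|x y]; rewrite /hom_inv_fun ?gmulf1 ?invg1 // gmulfM invgM.
exact: mulgC.
Qed.
HB.instance Definition _ u :=
  isUMagmaMorphism.Build G A (hom_inv_fun u) (hom_inv_subproof u).
Definition hom_inv u : Hom := hom_inv_fun u : {hom G -> A}.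

Fact hom_mulA : associative hom_mul.
Proof. by move=> u v w; apply: hom_ext => x; apply: mulgA. Qed.
Fact hom_mul1 : left_id hom_one hom_mul.
Proof. by move=> u; apply: hom_ext => x; apply: mul1g. Qed.
Fact hom_mulr1 : right_id hom_one hom_mul.
Proof. by move=> u; apply: hom_ext => x; apply: mulg1. Qed.
Fact hom_mulV : left_inverse hom_one hom_inv hom_mul.
Proof. by move=> u; apply: hom_ext => x; apply: mulVg. Qed.
Fact hom_mulrV : right_inverse hom_one hom_inv hom_mul.
Proof. by move=> u; apply: hom_ext => x; apply: mulgV. Qed.
HB.instance Definition _ :=
  isGroup.Build Hom hom_mulA hom_mul1 hom_mulr1 hom_mulV hom_mulrV.

Fact hom_mulC : commutative (@mul Hom).
Proof. by move=> u v; apply: hom_ext => x; apply: mulgC. Qed.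
HB.instance Definition _ := isAbelian.Build Hom hom_mulC.

End HomGroup.

Section EndMonoid.
Variable G : groupType.

Definition End := {hom G -> G}.
HB.instance Definition _ := Choice.on End.

Definition end_one : End := idfun : {hom G -> G}.
Definition end_mul (f g : End) : End := (f \o g) : {hom G -> G}.

Fact end_mulA : associative end_mul.
Proof. by move=> f g h; apply: hom_ext. Qed.
Fact end_mul1 : left_id end_one end_mul.
Proof. by move=> f; apply: hom_ext. Qed.
Fact end_mulr1 : right_id end_one end_mul.
Proof. by move=> f; apply: hom_ext. Qed.
HB.instance Definition _ :=
  isMonoid.Build End end_mulA end_mul1 end_mulr1.

End EndMonoid.

Section LowerCentralSeries.
Variable G : groupType.
Implicit Types (A B : set G) (x y z : G).

Definition is_subgroup A := A 1 /\ forall x y, A x -> A y -> A (x / y).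

Definition commutator A B : set G :=
  smallest is_subgroup [set [~ a, b] | a in A & b in B].

(* MathComp's [~ a, b] is a^-1 * b^-1 * a * b; the subgroups are the same as
   with the convention a * b * a^-1 * b^-1.
   The series starts at lcs 1 = G; the value lcs 0 = G is a convention. *)
Definition lcs (r : nat) : set G := iter r.-1 (commutator^~ setT) setT.

(* Only used for A = lcs r, which is normal, so that left and right cosets
   agree. *)
Definition eqg_mod A x y := A (x / y).

Lemma smallest_subgroup A : is_subgroup (smallest is_subgroup A).
Proof.
split=> [B [[]] //|x y Ax Ay B BP].
by case: (BP) => -[_ BF] _; apply: BF; [apply: Ax|apply: Ay].
Qed.

Lemma lcs_subgroup r : is_subgroup (lcs r).
Proof. by case: r => [|[|r]] //; apply: smallest_subgroup. Qed.

Lemma lcs1 r : lcs r 1. Proof. by case: (lcs_subgroup r). Qed.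
Lemma lcsF r x y : lcs r x -> lcs r y -> lcs r (x / y).
Proof. by case: (lcs_subgroup r) => _; apply. Qed.
Lemma lcsV r x : lcs r x -> lcs r x^-1.
Proof. by move=> rx; rewrite -div1g; apply: lcsF => //; apply: lcs1. Qed.
Lemma lcsM r x y : lcs r x -> lcs r y -> lcs r (x * y).
Proof. by move=> rx ry; rewrite -[y]invgK; apply: lcsF => //; apply: lcsV. Qed.

Lemma lcsR r x y : (0 < r)%N -> lcs r x -> lcs r.+1 [~ x, y].
Proof.
case: r => // r _ rx; apply: (@sub_gen_smallest _ is_subgroup).
by exists x => //; exists y.
Qed.

Lemma lcs_ind r A : (0 < r)%N -> is_subgroup A ->
  (forall x y, lcs r x -> A [~ x, y]) -> lcs r.+1 `<=` A.
Proof.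
case: r => // r _ Agr AR; apply: smallest_sub => // _ [x rx [y _ <-]].
exact: AR.
Qed.

End LowerCentralSeries.
Arguments lcs : clear implicits.

Lemma lcs_morph (G H : groupType) (f : {hom G -> H}) r x :
  lcs G r x -> lcs H r (f x).
Proof.
elim: r x => [|[|r] IHr] x //.
move: x; apply: lcs_ind => //.
  split=> [|x y fx fy]; first by rewrite gmulf1; apply: lcs1.
  by rewrite gmulfF; apply: lcsF.
by move=> x y rx; rewrite gmulfR; apply: lcsR => //; apply: IHr.
Qed.

Section LcsTheory.
Variable G : groupType.
Implicit Types (x y z : G) (f g : End G).

Section Conj.
Variable y : G.
Definition conjg_fun x := x ^ y.
Fact conjg_subproof : monoid_morphism conjg_fun.
Proof. by split=> [|x z]; rewrite /conjg_fun (conj1g, conjMg). Qed.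
HB.instance Definition _ :=
  isUMagmaMorphism.Build G G conjg_fun conjg_subproof.
End Conj.

Lemma lcsJ r x y : lcs G r x -> lcs G r (x ^ y).
Proof. exact: (@lcs_morph _ _ (conjg_fun y)). Qed.

Lemma lcsJV r x y : lcs G r x -> lcs G r (y * x * y^-1).
Proof. by move=> /(@lcsJ _ _ y^-1); rewrite conjgE invgK mulgA. Qed.

Lemma lcsS r : lcs G r.+1 `<=` lcs G r.
Proof.
case: r => // r; apply: lcs_ind => //; first exact: lcs_subgroup.
by move=> x y rx; rewrite commgEl; apply: lcsM; [apply: lcsV|apply: lcsJ].
Qed.

Lemma lcs_le r s : (r <= s)%N -> lcs G s `<=` lcs G r.
Proof.
move=> /subnK <-; elim: (s - r)%N => // k IHk x /lcsS; exact: IHk.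
Qed.

Lemma eqg_mod_refl r x : eqg_mod (lcs G r) x x.
Proof. by rewrite /eqg_mod mulgV; apply: lcs1. Qed.
Lemma eqg_mod_sym r x y : eqg_mod (lcs G r) x y -> eqg_mod (lcs G r) y x.
Proof. by rewrite /eqg_mod => /lcsV; rewrite invgF. Qed.
Lemma eqg_mod_trans r y x z :
  eqg_mod (lcs G r) x y -> eqg_mod (lcs G r) y z -> eqg_mod (lcs G r) x z.
Proof. by move=> xy yz; rewrite /eqg_mod -(divgKA y); apply: lcsM. Qed.

Lemma eqg_modM r x x' y y' : eqg_mod (lcs G r) x x' ->
  eqg_mod (lcs G r) y y' -> eqg_mod (lcs G r) (x * y) (x' * y').
Proof.
move=> xx' yy'; rewrite /eqg_mod.
rewrite (_ : _ / _ = (x / x') * (x' * (y / y') * x'^-1)); last first.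
  by rewrite invgM !mulgA mulgVK.
by apply: lcsM => //; apply: lcsJV.
Qed.

Lemma eqg_modV r x y :
  eqg_mod (lcs G r) x y -> eqg_mod (lcs G r) x^-1 y^-1.
Proof.
move=> /eqg_mod_sym; rewrite /eqg_mod => /(@lcsJV _ _ x^-1).
by rewrite !invgK !mulgA mulgVK.
Qed.

Lemma eqg_modF r x x' y y' : eqg_mod (lcs G r) x x' ->
  eqg_mod (lcs G r) y y' -> eqg_mod (lcs G r) (x / y) (x' / y').
Proof. by move=> xx' /eqg_modV; apply: eqg_modM. Qed.

Lemma eqg_mod_commute r x y :
  lcs G r x -> lcs G r y -> eqg_mod (lcs G r.+1) (x * y) (y * x).
Proof.
case: r => // r rx ry; rewrite /eqg_mod [x * y]commgCV mulgK.
by apply: lcsR => //; apply: lcsV.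
Qed.

End LcsTheory.

Section GradedQuotient.
Variables (G : groupType) (r : nat).

Definition lcs_sub := {x : G | x \in lcs G r}.
HB.instance Definition _ := SubChoice.on lcs_sub.

Fact lcs_sub_subproof : group_closed (fun x : G => x \in lcs G r).
Proof.
split=> [|x y]; first exact/mem_set/lcs1.
by rewrite !unfold_in => /set_mem rx /set_mem ry; apply: mem_set; apply: lcsF.
Qed.
HB.instance Definition _ := SubChoice_isSubGroup.Build G
  (fun x : G => x \in lcs G r) lcs_sub lcs_sub_subproof.

Lemma lcs_subP (x : lcs_sub) : lcs G r (val x).
Proof. exact/set_mem/(valP x). Qed.

Definition gr_rel (x y : lcs_sub) : bool :=
  `[< eqg_mod (lcs G r.+1) (val x) (val y) >].

Fact gr_rel_refl : reflexive gr_rel.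
Proof. by move=> x; apply/asboolP/eqg_mod_refl. Qed.
Fact gr_rel_sym : symmetric gr_rel.
Proof. by move=> x y; apply/asboolP/asboolP => /eqg_mod_sym. Qed.
Fact gr_rel_trans : transitive gr_rel.
Proof.
by move=> y x z /asboolP xy /asboolP yz; apply/asboolP/(eqg_mod_trans xy).
Qed.
Canonical gr_equiv := EquivRel gr_rel gr_rel_refl gr_rel_sym gr_rel_trans.

Definition lcs_gr := {eq_quot gr_rel}.
HB.instance Definition _ := Choice.on lcs_gr.
HB.instance Definition _ := EqQuotient.on lcs_gr.

Definition lcs_class (x : G) (rx : lcs G r x) : lcs_gr :=
  \pi_lcs_gr (exist _ x (mem_set rx) : lcs_sub).

Lemma lcs_piP (x y : lcs_sub) :
  \pi_lcs_gr x = \pi y <-> eqg_mod (lcs G r.+1) (val x) (val y).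
Proof. by split=> [/eqmodP/asboolP|xy]; last exact/eqmodP/asboolP. Qed.

Definition gr_one : lcs_gr := \pi_lcs_gr (1 : lcs_sub).
Definition gr_mul (a b : lcs_gr) : lcs_gr := \pi_lcs_gr (repr a * repr b).
Definition gr_inv (a : lcs_gr) : lcs_gr := \pi_lcs_gr (repr a)^-1.

Fact gr_piM x y : \pi_lcs_gr (x * y) = gr_mul (\pi x) (\pi y).
Proof.
by apply/lcs_piP; rewrite !valM; apply: eqg_modM; apply/lcs_piP; rewrite reprK.
Qed.
Fact gr_piV x : \pi_lcs_gr x^-1 = gr_inv (\pi x).
Proof.
apply/lcs_piP; rewrite -[x^-1]div1g -[(repr _)^-1]div1g !gmulfF.
apply: eqg_modF; first exact: eqg_mod_refl.
by apply/lcs_piP; rewrite reprK.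
Qed.

Fact gr_mulA : associative gr_mul.
Proof.
move=> a b c; rewrite -[a]reprK -[b]reprK -[c]reprK.
move: (repr a) (repr b) (repr c) => x y z.
by rewrite -(gr_piM y z) -(gr_piM x y) -(gr_piM x) -(gr_piM _ z) mulgA.
Qed.
Fact gr_mul1 : left_id gr_one gr_mul.
Proof. by move=> a; rewrite -[a]reprK -gr_piM mul1g. Qed.
Fact gr_mulr1 : right_id gr_one gr_mul.
Proof. by move=> a; rewrite -[a]reprK -gr_piM mulg1. Qed.
Fact gr_mulV : left_inverse gr_one gr_inv gr_mul.
Proof. by move=> a; rewrite -[a]reprK -gr_piV -gr_piM mulVg. Qed.
Fact gr_mulrV : right_inverse gr_one gr_inv gr_mul.
Proof. by move=> a; rewrite -[a]reprK -gr_piV -gr_piM mulgV. Qed.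
HB.instance Definition _ :=
  isGroup.Build lcs_gr gr_mulA gr_mul1 gr_mulr1 gr_mulV gr_mulrV.

Fact gr_mulC : commutative (@mul lcs_gr).
Proof.
move=> a b; apply/lcs_piP; rewrite !valM.
by apply: eqg_mod_commute; apply: lcs_subP.
Qed.
HB.instance Definition _ := isAbelian.Build lcs_gr gr_mulC.

Lemma lcs_classP x (rx : lcs G r x) y (ry : lcs G r y) :
  lcs_class rx = lcs_class ry <-> eqg_mod (lcs G r.+1) x y.
Proof. exact: lcs_piP. Qed.

Lemma lcs_classM x (rx : lcs G r x) y (ry : lcs G r y) (rxy : lcs G r (x * y)) :
  lcs_class rxy = lcs_class rx * lcs_class ry.
Proof.
rewrite [RHS](_ : _ = gr_mul (lcs_class rx) (lcs_class ry)) //.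
by rewrite -gr_piM; apply/lcs_piP; rewrite valM; apply: eqg_mod_refl.
Qed.

End GradedQuotient.


Section HomLcs.
Variable G : groupType.
Implicit Types (x y z : G).

Lemma lcs_full x : lcs G 1 x. Proof. by []. Qed.

Lemma hom_lcs2 (A : abelGroupType) (u : {hom G -> A}) x :
  lcs G 2 x -> u x = 1.
Proof.
move: x; apply: lcs_ind => // [|x y _].
  by split=> [|x y ux uy]; rewrite ?gmulf1 // gmulfF ux uy divg1.
by rewrite gmulfR; apply/eqP/commgP/mulgC.
Qed.

Lemma eqg_modJ r x y : (0 < r)%N -> lcs G r x ->
  eqg_mod (lcs G r.+1) (x ^ y) x.
Proof.
move=> r0 rx; rewrite /eqg_mod (_ : _ / _ = x * [~ x, y] * x^-1).
  exact/lcsJV/lcsR.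
by rewrite commgEl mulVKg.
Qed.

Lemma commgMr x y z : [~ x, y * z] = [~ x, z] * [~ x, y] ^ z.
Proof. by rewrite /commg /conjg !gnorm. Qed.

Lemma commgMl x y z : [~ x * y, z] = [~ x, z] ^ y * [~ y, z].
Proof. by rewrite /commg /conjg !gnorm. Qed.

Section CommHom.
Variables (r : nat) (r_gt0 : (0 < r)%N) (x : G) (rx : lcs G r x).
Definition commg_class y := lcs_class (lcsR y r_gt0 rx).
Fact commg_class_subproof : monoid_morphism commg_class.
Proof.
have cM y z : commg_class (y * z) = commg_class y * commg_class z.
  rewrite [RHS]mulgC.
  rewrite -(lcs_classM _ _ (lcsM (lcsR z r_gt0 rx) (lcsR y r_gt0 rx))).
  apply/lcs_classP; rewrite commgMr; apply: eqg_modM.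
    exact: eqg_mod_refl.
  by apply: eqg_modJ => //; apply: lcsR.
by split=> //; apply: (mulgI (commg_class 1)); rewrite -cM !mulg1.
Qed.
HB.instance Definition _ :=
  isUMagmaMorphism.Build G (lcs_gr G r.+1) commg_class commg_class_subproof.
End CommHom.

Lemma lcs_class_eq1 r x (rx : lcs G r x) : lcs_class rx = 1 -> lcs G r.+1 x.
Proof.
move=> x1; have /lcs_classP : lcs_class rx = lcs_class (lcs1 G r).
  by rewrite x1; apply/lcs_piP; apply: eqg_mod_refl.
by rewrite /eqg_mod divg1.
Qed.

Lemma lcsR2 r x y : (0 < r)%N -> lcs G r x -> lcs G 2 y ->
  lcs G r.+2 [~ x, y].
Proof.
move=> r_gt0 rx y2; apply: (@lcs_class_eq1 _ _ (lcsR y r_gt0 rx)).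
exact: (hom_lcs2 (commg_class r_gt0 rx)).
Qed.

End HomLcs.

Section EndFiltration.
Variable G : groupType.
Implicit Types (f g : End G) (x y : G).

(* The kernel of the monoid morphism End(G) -> End(G / lcs r.+1). *)
Definition end_lcs (r : nat) : set (End G) :=
  [set f | forall x, lcs G r.+1 (f x / x)].

Lemma fix_subgroup f r : is_subgroup [set x | lcs G r (f x / x)].
Proof.
split=> [|x y fx fy] /=; first by rewrite gmulf1 divg1; apply: lcs1.
by rewrite gmulfF; apply: (eqg_modF fx fy).
Qed.

Lemma end_lcs_le r s f : (r <= s)%N -> end_lcs s f -> end_lcs r f.
Proof. by move=> rs sf x; apply: lcs_le (sf x). Qed.

Lemma end_lcs_fix f r x : end_lcs 1 f -> lcs G r x -> lcs G r.+1 (f x / x).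
Proof.
move=> f1; case: r => // r; elim: r x => [x _|r IHr]; first exact: f1.
apply: lcs_ind => // [|x y rx]; first exact: fix_subgroup.
have fx := IHr _ rx; have fy := f1 y; rewrite /= gmulfR.
rewrite -/(eqg_mod _ _ _).
apply: (@eqg_mod_trans _ _ [~ x, f y]).
  rewrite -[f x](mulgVK x) commgMl /eqg_mod mulgK.
  by apply: lcsJ; apply: lcsR.
rewrite -[f y](mulgVK y) commgMr /eqg_mod.
by apply: lcsJV; apply: lcsJ; apply: lcsR2.
Qed.

Section Level.
Variable r : nat.

Definition EndF := {f : End G | f \in end_lcs r}.
HB.instance Definition _ := SubChoice.on EndF.

Fact EndF_subproof : umagma_closed (fun f : End G => f \in end_lcs r).
Proof.
split=> [|f g].
  by apply: mem_set => x /=; rewrite mulgV; apply: lcs1.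
rewrite !unfold_in => /set_mem rf /set_mem rg; apply: mem_set => x.
exact: (eqg_mod_trans (rf (g x)) (rg x)).
Qed.
HB.instance Definition _ := SubChoice_isSubMonoid.Build (End G)
  (fun f : End G => f \in end_lcs r) EndF EndF_subproof.

Lemma EndFP (f : EndF) x : lcs G r.+1 (val f x / x).
Proof. exact: set_mem (valP f) x. Qed.

Variable N : nat.

Definition end_rel (f g : EndF) : bool :=
  `[< forall x, eqg_mod (lcs G N.+1) (val f x / x) (val g x / x) >].

Lemma end_relP (f g : EndF) :
  reflect (forall x, eqg_mod (lcs G N.+1) (val f x) (val g x)) (end_rel f g).
Proof.
apply: (iffP (asboolP _)) => fg x; last first.
  by apply: eqg_modF => //; apply: eqg_mod_refl.
rewrite -[val f x](mulgVK x) -[val g x](mulgVK x).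
by apply: eqg_modM => //; apply: eqg_mod_refl.
Qed.

Fact end_rel_refl : reflexive end_rel.
Proof. by move=> f; apply/end_relP=> x; apply: eqg_mod_refl. Qed.
Fact end_rel_sym : symmetric end_rel.
Proof.
by move=> f g; apply/end_relP/end_relP => fg x; apply: eqg_mod_sym.
Qed.
Fact end_rel_trans : transitive end_rel.
Proof.
move=> g f h /end_relP fg /end_relP gh; apply/end_relP=> x.
exact: eqg_mod_trans (gh x).
Qed.
Canonical end_equiv := EquivRel end_rel end_rel_refl end_rel_sym end_rel_trans.

Definition endQ := {eq_quot end_rel}.
HB.instance Definition _ := Choice.on endQ.
HB.instance Definition _ := EqQuotient.on endQ.

Lemma endQ_piP (f g : EndF) : \pi_endQ f = \pi g <->
  forall x, eqg_mod (lcs G N.+1) (val f x) (val g x).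
Proof. by split=> [/eqmodP/end_relP|fg]; last exact/eqmodP/end_relP. Qed.

Definition endQ_one : endQ := \pi_endQ (1 : EndF).
Definition endQ_mul (a b : endQ) : endQ := \pi_endQ (repr a * repr b).

Fact endQ_piM (f g : EndF) : \pi_endQ (f * g) = endQ_mul (\pi f) (\pi g).
Proof.
apply/endQ_piP=> x; rewrite !valM /=.
apply: (@eqg_mod_trans _ _ (val (repr (\pi_endQ f)) (val g x))).
  by move: (val g x); apply/endQ_piP; rewrite reprK.
rewrite /eqg_mod -gmulfF; apply: lcs_morph; move: x.
by apply/endQ_piP; rewrite reprK.
Qed.

Fact endQ_mulA : associative endQ_mul.
Proof.
move=> a b c; rewrite -[a]reprK -[b]reprK -[c]reprK.
move: (repr a) (repr b) (repr c) => f g h.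
by rewrite -(endQ_piM g h) -(endQ_piM f g) -(endQ_piM f) -(endQ_piM _ h) mulgA.
Qed.
Fact endQ_mul1 : left_id endQ_one endQ_mul.
Proof. by move=> a; rewrite -[a]reprK -endQ_piM mul1g. Qed.
Fact endQ_mulr1 : right_id endQ_one endQ_mul.
Proof. by move=> a; rewrite -[a]reprK -endQ_piM mulg1. Qed.
HB.instance Definition _ :=
  isMonoid.Build endQ endQ_mulA endQ_mul1 endQ_mulr1.

End Level.

Section Johnson.
Variable r : nat.
Local Notation L := (lcs_gr G).

Section JohnsonHom.
Variable f : EndF r.

Definition johnson_class x : L r.+1 := lcs_class (EndFP f x).
Fact johnson_class_subproof : monoid_morphism johnson_class.
Proof.
have cM x y : johnson_class (x * y) = johnson_class x * johnson_class y.
  rewrite -(lcs_classM _ _ (lcsM (EndFP f x) (EndFP f y))); apply/lcs_classP.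
  rewrite gmulfM (_ : _ / _ = val f x / x * (val f y / y) ^ x^-1).
    apply: eqg_modM; first exact: eqg_mod_refl.
    by apply: eqg_modJ => //; apply: EndFP.
  by rewrite /conjg !gnorm.
by split=> //; apply: (mulgI (johnson_class 1)); rewrite -cM !mulg1.
Qed.
HB.instance Definition _ :=
  isUMagmaMorphism.Build G (L r.+1) johnson_class johnson_class_subproof.

Definition johnson_fun (a : L 1) : L r.+1 := johnson_class (val (repr a)).

Lemma johnson_funE x (x1 : lcs G 1 x) :
  johnson_fun (lcs_class x1) = johnson_class x.
Proof.
rewrite /johnson_fun; apply/divg1_eq; rewrite -gmulfF.
apply: hom_lcs2.
apply/(lcs_piP (repr (lcs_class x1)) (exist _ x (mem_set x1))).
by rewrite reprK.
Qed.

Fact johnson_fun_subproof : monoid_morphism johnson_fun.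
Proof.
have cM a b : johnson_fun (a * b) = johnson_fun a * johnson_fun b.
  have -> : johnson_fun a * johnson_fun b =
    johnson_class (val (repr a) * val (repr b)) by rewrite [RHS]gmulfM.
  rewrite -(johnson_funE (lcsM (lcs_subP (repr a)) (lcs_subP (repr b)))).
  congr johnson_fun; apply/lcs_piP.
  by rewrite valM; apply: eqg_mod_refl.
by split=> //; apply: (mulgI (johnson_fun 1)); rewrite -cM !mulg1.
Qed.
HB.instance Definition _ :=
  isUMagmaMorphism.Build (L 1) (L r.+1) johnson_fun johnson_fun_subproof.
Definition johnson_hom : Hom (L 1) (L r.+1) :=
  johnson_fun : {hom L 1 -> L r.+1}.

End JohnsonHom.
End Johnson.
End EndFiltration.

Section FreeGroup.
Variable n : nat.

(* (i, false) is the generator x_i, and (i, true) its inverse. *)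
Definition letter := ('I_n * bool)%type.
Implicit Types (a b : letter) (u v w : seq letter).

Definition letterV a : letter := (a.1, ~~ a.2).

Definition reduced w := sorted (fun a b => b != letterV a) w.

(* Left multiplication of a reduced word by a letter. *)
Definition push a w :=
  if w is b :: w' then if b == letterV a then w' else a :: w else [:: a].

Lemma letterVK : involutive letterV.
Proof. by case=> i b; rewrite /letterV /= negbK. Qed.

Lemma letterV_sym a b : (b != letterV a) = (a != letterV b).
Proof. by rewrite -(inv_eq letterVK) eq_sym. Qed.

Lemma push_reduced a w : reduced w -> reduced (push a w).
Proof.
case: w => //= b w; case: ifPn => [_ /path_sorted //|ba bw] /=.
by rewrite ba.
Qed.

Lemma foldr_push_reduced u w : reduced w -> reduced (foldr push w u).
Proof. by move=> rw; elim: u => //= a u; apply: push_reduced. Qed.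

Lemma pushVK a w : reduced w -> push (letterV a) (push a w) = w.
Proof.
case: w => [|b w] /=; first by rewrite letterVK eqxx.
case: ifPn => [/eqP-> {b}|_ _ /=]; last by rewrite letterVK eqxx.
by case: w => //= c w; case/andP => /negbTE->.
Qed.

Lemma pushK a w : reduced w -> push a (push (letterV a) w) = w.
Proof. by move=> rw; rewrite -{1}[a]letterVK pushVK. Qed.

Lemma foldr_push a v w : reduced v -> reduced w ->
  foldr push w (push a v) = push a (foldr push w v).
Proof.
case: v => //= b v bv rw; case: ifPn => [/eqP->|//].
by rewrite pushK //; apply: foldr_push_reduced.
Qed.

Lemma reduced_id u : reduced u -> foldr push [::] u = u.
Proof.
elim: u => // a u IHu ru; rewrite /= IHu; last exact: path_sorted ru.
by case: u ru {IHu} => //= b u /andP[/negbTE->].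
Qed.

Record freeg := FreeG { word :> seq letter; _ : reduced word }.
HB.instance Definition _ := [isSub for word].
HB.instance Definition _ := [Countable of freeg by <:].

Implicit Types x y z : freeg.

Lemma word_reduced x : reduced x. Proof. exact: valP. Qed.

Definition free_one := @FreeG [::] isT.
Definition free_mul x y := FreeG (foldr_push_reduced x (word_reduced y)).

Fact free_inv_subproof x : reduced (rev (map letterV x)).
Proof.
rewrite /reduced rev_sorted sorted_map; apply: sub_sorted (word_reduced x).
by move=> a b /=; rewrite letterVK eq_sym.
Qed.
Definition free_inv x := FreeG (free_inv_subproof x).

Fact free_mulA : associative free_mul.
Proof.
move=> x y z; apply: val_inj => /=; elim: (word x) => //= a u ->.
rewrite foldr_push //; last exact: word_reduced.
exact/foldr_push_reduced/word_reduced.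
Qed.
Fact free_mul1 : left_id free_one free_mul.
Proof. by move=> x; apply: val_inj. Qed.
Fact free_mulr1 : right_id free_one free_mul.
Proof. by move=> x; apply: val_inj; apply/reduced_id/word_reduced. Qed.
Fact free_mulV : left_inverse free_one free_inv free_mul.
Proof.
move=> x; apply: val_inj => /=; elim: (word x) => //= a u IHu.
by rewrite rev_cons foldr_rcons /= letterVK eqxx.
Qed.
Fact free_mulrV : right_inverse free_one free_inv free_mul.
Proof.
move=> x; rewrite -{1}(_ : free_inv (free_inv x) = x) ?free_mulV //.
by apply: val_inj; rewrite /= map_rev revK mapK //; apply: letterVK.
Qed.
HB.instance Definition _ :=
  isGroup.Build freeg free_mulA free_mul1 free_mulr1 free_mulV free_mulrV.

Definition free_gen (i : 'I_n) : freeg := @FreeG [:: (i, false)] isT.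

Lemma freeg_ind (A : set freeg) :
  is_subgroup A -> (forall i, A (free_gen i)) -> forall x, A x.
Proof.
move=> [A1 AF] Agen.
have AV x : A x -> A x^-1 by move=> Ax; rewrite -div1g; apply: AF.
have Al i (b : bool) : A (@FreeG [:: (i, b)] isT).
  case: b; last exact: Agen.
  rewrite (_ : FreeG _ = (free_gen i)^-1); first exact/AV/Agen.
  exact: val_inj.
case=> w; elim: w => [|[i b] w IHw] rw.
  by rewrite (_ : FreeG rw = 1) //; apply: val_inj.
have rw' : reduced w := path_sorted rw.
rewrite (_ : FreeG rw = @FreeG [:: (i, b)] isT * FreeG rw').
  by rewrite -[FreeG rw']invgK; apply: AF => //; apply/AV/IHw.
by apply: val_inj => /=; case: w rw {rw' IHw} => //= c w /andP[/negbTE->].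
Qed.

Section FreeLift.
Variables (G : groupType) (s : 'I_n -> G).

Definition letter_val a : G := if a.2 then (s a.1)^-1 else s a.1.
Definition free_lift x : G := \prod_(a <- word x) letter_val a.

Lemma prod_push a w :
  \prod_(b <- push a w) letter_val b =
  letter_val a * \prod_(b <- w) letter_val b.
Proof.
case: w => [|b w] /=; first by rewrite big_seq1 big_nil mulg1.
case: ifPn => [/eqP->|_]; rewrite !big_cons // mulgA.
rewrite (_ : _ * letter_val _ = 1) ?mul1g //.
by case: a => i [] /=; rewrite /letter_val /= ?mulgV ?mulVg.
Qed.

Fact free_lift_subproof : monoid_morphism free_lift.
Proof.
split=> [|x y]; first by rewrite /free_lift big_nil.
rewrite /free_lift /=; elim: (word x) => /= [|a u IHu].
  by rewrite big_nil mul1g.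
by rewrite prod_push IHu big_cons mulgA.
Qed.
HB.instance Definition _ :=
  isUMagmaMorphism.Build freeg G free_lift free_lift_subproof.

Lemma free_liftE i : free_lift (free_gen i) = s i.
Proof. by rewrite /free_lift big_seq1. Qed.

End FreeLift.

Lemma free_endP (f : End freeg) r :
  (forall i, lcs freeg r (f (free_gen i) / free_gen i)) ->
  forall x, lcs freeg r (f x / x).
Proof. by move=> fgen; apply: freeg_ind => //; apply: fix_subgroup. Qed.

Lemma EndF_right_inverse r N (f : EndF freeg r) : (0 < r)%N ->
  exists g : EndF freeg r,
    forall x, eqg_mod (lcs freeg N.+1) (val (f * g) x) x.
Proof.
move=> r_gt0; elim: N => [|N [g fgN]]; first by exists 1.
have [rN|Nr] := leqP r N; last first.
  by exists 1 => x; rewrite mulg1; apply: lcs_le (EndFP f x).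
pose k : End freeg := val (f * g).
pose c i := k (free_gen i) / free_gen i.
have cN i : lcs freeg N.+1 (c i) by apply: fgN.
pose h : End freeg := free_lift (fun i => (c i)^-1 * free_gen i) : {hom _ -> _}.
have hN : end_lcs N h.
  by apply: free_endP => i; rewrite /h /= free_liftE mulgK; apply: lcsV.
have hr : h \in end_lcs r by apply: mem_set; apply: end_lcs_le hN.
exists (g * (Sub h hr : EndF freeg r)) => x; rewrite mulgA valM SubK /=.
move: x; apply: (@free_endP (k * h) N.+2) => i.
have -> : (k * h) (free_gen i) = (k (c i))^-1 * (c i * free_gen i).
  rewrite [LHS](_ : _ = k (h (free_gen i))) //.
  have -> : h (free_gen i) = (c i)^-1 * free_gen i by rewrite /h /= free_liftE.
  have eM (e : End freeg) y z : e (y^-1 * z) = (e y)^-1 * e z.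
    by rewrite gmulfM gmulfV.
  by rewrite eM; congr (_ * _); rewrite /c mulgVK.
have k1 : end_lcs 1 k.
  by apply: end_lcs_le r_gt0 _; apply: EndFP.
have /eqg_mod_sym kc := end_lcs_fix k1 (cN i).
have := eqg_modM (eqg_mod_refl N.+2 (k (c i))^-1) kc.
by rewrite mulVg /eqg_mod divg1 [_ * (_ * free_gen i)]mulgA mulgK.
Qed.

Section EndQuotientGroup.
Variables (r : nat) (r_gt0 : (0 < r)%N) (N : nat).

(* endQ freeg r N is a group for r >= 1, but only a monoid for r = 0, hence the
   hypothesis among the parameters. *)
Definition endG of (0 < r)%N := endQ freeg r N.
HB.instance Definition _ := Monoid.copy (endG r_gt0) (endQ freeg r N).
HB.instance Definition _ := EqQuotient.copy (endG r_gt0) (endQ freeg r N).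

Fact endG_right_inverse (a : endG r_gt0) : exists b : endG r_gt0, a * b = 1.
Proof.
have [g fg] := EndF_right_inverse N (repr a) r_gt0.
exists (\pi_(endG r_gt0) g); rewrite -[a in LHS]reprK.
by rewrite -[LHS]endQ_piM; apply/endQ_piP.
Qed.

Definition endG_inv (a : endG r_gt0) := projT1 (cid (endG_right_inverse a)).
HB.instance Definition _ := hasInv.Build (endG r_gt0) endG_inv.

Fact endG_mulrV : right_inverse 1 endG_inv (@mul (endG r_gt0)).
Proof. by move=> a; apply: (projT2 (cid (endG_right_inverse a))). Qed.
Fact endG_mulV : left_inverse 1 endG_inv (@mul (endG r_gt0)).
Proof.
move=> a; have aK := endG_mulrV a; have bK := endG_mulrV (endG_inv a).
rewrite -{2}[a]mulg1 -[X in _ * (_ * X)]bK [a * _]mulgA aK mul1g.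
exact: endG_mulrV.
Qed.
HB.instance Definition _ :=
  Monoid_isGroup.Build (endG r_gt0) endG_mulV endG_mulrV.

End EndQuotientGroup.

End FreeGroup.

Section JohnsonHomomorphism.
Variables (n r : nat) (r_gt0 : (0 < r)%N).
Local Notation F := (freeg n).

Definition gr_end := endG n r.+1 r_gt0.
HB.instance Definition _ := Group.on gr_end.
HB.instance Definition _ := EqQuotient.on gr_end.

Definition gr_end_class (f : EndF F r) : gr_end := \pi_gr_end f.

Definition johnson (a : gr_end) : Hom (lcs_gr F 1) (lcs_gr F r.+1) :=
  johnson_hom (repr a).

Lemma johnsonE (f : EndF F r) (x : F) (x1 : lcs F 1 x) :
  johnson (gr_end_class f) (lcs_class x1) = lcs_class (EndFP f x).
Proof.
rewrite /johnson [LHS]johnson_funE; apply/lcs_classP.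
apply: eqg_modF; last exact: eqg_mod_refl.
by move: x {x1}; apply/endQ_piP; rewrite [LHS]reprK.
Qed.

Lemma johnsonP (a : gr_end) (u : Hom (lcs_gr F 1) (lcs_gr F r.+1)) :
  (forall x (x1 : lcs F 1 x), johnson a (lcs_class x1) = u (lcs_class x1)) ->
  johnson a = u.
Proof.
move=> au; apply: hom_ext => b; rewrite -[b]reprK.
rewrite (_ : \pi _ = lcs_class (lcs_subP (repr b))) ?au //.
by apply/lcs_piP; apply: eqg_mod_refl.
Qed.

Fact johnson_subproof : monoid_morphism johnson.
Proof.
have cM a b : johnson (a * b) = johnson a * johnson b.
  apply: johnsonP => x x1.
  rewrite [RHS](_ : _ = johnson a (lcs_class x1) * johnson b (lcs_class x1)) //.
  rewrite -[a]reprK -[b]reprK -!/(gr_end_class _).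
  move: (repr a) (repr b) => f g.
  have -> : gr_end_class f * gr_end_class g = gr_end_class (f * g).
    by rewrite [RHS]endQ_piM.
  rewrite !johnsonE -(lcs_classM _ _ (lcsM (EndFP f x) (EndFP g x))).
  apply/lcs_classP; rewrite valM.
  rewrite -(divgKA (val g x) (val f (val g x)) x^-1).
  apply: eqg_modM; last exact: eqg_mod_refl.
  apply/(lcs_classP (EndFP f (val g x)) (EndFP f x)).
  apply: divg1_eq; rewrite -[LHS](gmulfF (johnson_class f)).
  by apply: hom_lcs2; apply: lcs_le (EndFP g x).
by split=> //; apply: (mulgI (johnson 1)); rewrite -cM !mulg1.
Qed.
HB.instance Definition _ := isUMagmaMorphism.Build gr_end
  (Hom (lcs_gr F 1) (lcs_gr F r.+1)) johnson johnson_subproof.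

End JohnsonHomomorphism.

Arguments gr_end n {r} r_gt0.
Arguments johnson {n r} r_gt0 a.
Arguments gr_end_class {n r} r_gt0 f.

(* Main.v *)
(** Injectivity: [f(x)x^-1] determines [f(x)].  Commutativity of the graded
    piece is then inherited from the target.  Surjectivity uses freeness: given
    [u], lift each [u(x_i)] to [c_i] in Gamma_(r+1); the endomorphism
    [x_i |-> c_i x_i] maps to [u], since a homomorphism from [H] to an abelian
    group is determined by the images of the generators. *)
Require Import Defs.
From HB Require Import structures.
From mathcomp Require Import all_boot generic_quotient.
From mathcomp Require Import boolp classical_sets.

Set Implicit Arguments.
Unset Strict Implicit.
Unset Printing Implicit Defensive.

Local Open Scope group_scope.

Lemma lcs_classF (G : groupType) r (x y : G) (rx : lcs G r x) (ry : lcs G r y)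
  (rxy : lcs G r (x / y)) : lcs_class rxy = lcs_class rx / lcs_class ry.
Proof.
have rz : lcs G r (x / y * y) by rewrite mulgVK.
apply: (mulIg (lcs_class ry)); rewrite mulgVK -(lcs_classM _ _ rz).
by apply/lcs_classP; rewrite mulgVK; apply: eqg_mod_refl.
Qed.

Lemma lcs_gr_surj (G : groupType) r (a : lcs_gr G r) :
  exists x (rx : lcs G r x), a = lcs_class rx.
Proof.
exists (val (repr a)), (lcs_subP (repr a)); rewrite -[LHS]reprK.
by apply/lcs_piP; apply: eqg_mod_refl.
Qed.

(** The elements of the free group at whose classes [u] and [v] agree form a subgroup containing the
    generators. *)
Lemma free_abel_hom_ext n (A : abelGroupType)
  (u v : {hom lcs_gr (freeg n) 1 -> A}) :
  (forall i, u (lcs_class (lcs_full (free_gen i))) =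
             v (lcs_class (lcs_full (free_gen i)))) -> u = v.
Proof.
move=> uv; apply: hom_ext => a; have [x [x1 ->]] := lcs_gr_surj a.
(* [lcs_class] takes a membership proof; fixing it to [lcs_full x] makes agreement a condition on
   [x] alone. *)
rewrite (Prop_irrelevance x1 (lcs_full x)).
pose E : set (freeg n) :=
  fun y => u (lcs_class (lcs_full y)) = v (lcs_class (lcs_full y)).
apply: (@freeg_ind n E) => //; split=> [|y z yE zE].
  have c1 : lcs_class (lcs_full (1 : freeg n)) = 1.
    by apply/lcs_piP; apply: eqg_mod_refl.
  by rewrite /E c1 !gmulf1.
by rewrite /E (lcs_classF (lcs_full y) (lcs_full z)) !gmulfF yE zE.
Qed.

Theorem proposition3p8 (n r : nat) (n_gt0 : (1 <= n)%N) (r_gt0 : (1 <= r)%N) :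
  [/\ forall (f : EndF (freeg n) r) (x : freeg n),
        johnson r_gt0 (gr_end_class r_gt0 f) (lcs_class (lcs_full x)) =
        lcs_class (EndFP f x),
      commutative (@mul (gr_end n r_gt0)),
      {morph @johnson n r r_gt0 : a b / a * b}
    & bijective (@johnson n r r_gt0)].
Proof.
have jM : {morph @johnson n r r_gt0 : a b / a * b} by move=> a b; apply: gmulfM.
have j_inj : injective (@johnson n r r_gt0).
  move=> a b; rewrite -[a]reprK -[b]reprK -!/(gr_end_class r_gt0 _).
  move: (repr a) (repr b) => f g jfg; apply/endQ_piP => x.
  have := congr1 (fun u : Hom _ _ => u (lcs_class (lcs_full x))) jfg.
  rewrite !johnsonE => /lcs_classP fg.
  (* Both the relation defining [gr_end] and equality in the target are congruence modulo
     [lcs _ r.+2]; multiplying by [x] on the right cancels [x^-1]. *)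
  by have := eqg_modM fg (eqg_mod_refl r.+2 x); rewrite !mulgVK.
have j_surj (u : Hom (lcs_gr (freeg n) 1) (lcs_gr (freeg n) r.+1)) :
    exists a, johnson r_gt0 a = u.
  pose c i := val (repr (u (lcs_class (lcs_full (free_gen i))))).
  have cr i : lcs (freeg n) r.+1 (c i) by apply: lcs_subP.
  pose f : End (freeg n) :=
    free_lift (fun i => c i * free_gen i) : {hom _ -> _}.
  have fE i : f (free_gen i) / free_gen i = c i.
    by rewrite /f /= free_liftE mulgK.
  (* By [free_endP] it suffices to test generators, where the quotient is [c i]. *)
  have fr : f \in end_lcs r.
    by apply: mem_set; apply: free_endP => i; rewrite fE.
  pose F : EndF (freeg n) r := Sub f fr.
  exists (gr_end_class r_gt0 F); apply: free_abel_hom_ext => i.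
  rewrite johnsonE -[RHS]reprK; apply/lcs_piP.
  by rewrite SubK fE; apply: eqg_mod_refl.
split=> //.
- by move=> f x; apply: johnsonE.
- by move=> a b; apply: j_inj; rewrite !jM mulgC.
have [k jk] := choice j_surj.
(* The chosen section [k] is also a left inverse, by injectivity. *)
by exists k => // a; apply: j_inj; rewrite jk.
Qed.
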